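(* Let $q\in\mathbb{R}$ with $|q|>1$ and $n\ge0$. Let $\psi$ be the representation of $A(S^{2n+1}_q)$ given by the direct integral over $\lambda\in S^1$ of the representations $\psi^{(2n+1)}_\lambda$, and let $D=\lambda\frac{d}{d\lambda}$ be the unbounded operator on its Hilbert space. That is, in the Fourier basis $|k_0,k_1,\dots,k_n\rangle:=\lambda^{k_0}|k_1,\dots,k_n\rangle$ ($k_0\in\mathbb{Z}$, $k_1,\dots,k_n\in\mathbb{Z}_{\ge0}$), $D|k_0,\dots,k_n\rangle=k_0|k_0,\dots,k_n\rangle$. Then $$[D,\psi(x_1)]=\psi(x_1),\qquad [D,\psi(x_i)]=0\quad\text{for } i>1,$$ and $[D,\psi(a)]$ is bounded for every $a\in A(S^{2n+1}_q)$. If $n>0$, every eigenvalue of $D$ has infinite multiplicity, and hence $D$ does not have compact resolvent.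
   Context: The $*$-algebra $A(S^{2n+1}_q)$ is the unital complex $*$-algebra generated by $x_i,x_i^*$ ($i=1,\dots,n+1$) with relations $$x_ix_j=q\,x_jx_i\ (i<j),\qquad x_i^*x_j=q\,x_jx_i^*\ (i\neq j),\qquad [x_i,x_i^*]=(1-q^{-2})s_{i-1},\qquad s_{n+1}=1,$$ where $s_0:=0$ and $s_i:=s_{i-1}+x_i^*x_i$. For $\lambda\in S^1$, the $*$-representation $\psi^{(2n+1)}_\lambda$ acts on the Hilbert space with orthonormal basis $\{|k_1,\dots,k_n\rangle:k_i\in\mathbb{Z}_{\ge0}\}$ by $$\psi^{(2n+1)}_\lambda(x_1)|k_1,\dots,k_n\rangle=\lambda q^{-(k_1+\dots+k_n)}|k_1,\dots,k_n\rangle,$$ $$\psi^{(2n+1)}_\lambda(x_i)|k_1,\dots,k_n\rangle=(1-q^{-2k_{i-1}})^{1/2}q^{-(k_i+\dots+k_n)}|k_1,\dots,k_{i-1}-1,\dots,k_n\rangle,\quad i=2,\dots,n+1,$$ with $\psi^{(2n+1)}_\lambda(x_i^* )=\psi^{(2n+1)}_\lambda(x_i)^*$. The direct integral $\psi$ thus acts on $L^2(S^1)\otimes\ell^2(\mathbb{Z}_{\ge0}^n)$ and has orthonormal basis $|k_0,k_1,\dots,k_n\rangle$, with $$\psi(x_1)|k_0,\dots,k_n\rangle=q^{-(k_1+\dots+k_n)}|k_0+1,k_1,\dots,k_n\rangle,$$ $$\psi(x_i)|k_0,\dots,k_n\rangle=(1-q^{-2k_{i-1}})^{1/2}q^{-(k_i+\dots+k_n)}|k_0,\dots,k_{i-1}-1,\dots,k_n\rangle\quad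 (2\le i\le n+1).$$ The operator $D$ is the self-adjoint operator diagonal in this basis. Commutators are defined on the span of the basis vectors, and ''bounded'' means that they extend to bounded operators. *)

(* Defs.v *)
From HB Require Import structures.
From mathcomp Require Import all_boot all_order all_algebra generic_quotient complex.
From mathcomp Require Import all_classical all_reals all_analysis.

Set Implicit Arguments.
Unset Strict Implicit.
Unset Printing Implicit Defensive.

Import Order.TTheory GRing.Theory Num.Theory.
Import numFieldNormedType.Exports.

Local Open Scope complex_scope.
Local Open Scope quotient_scope.
Local Open Scope classical_set_scope.
Local Open Scope ring_scope.

HB.mixin Record Algebra_isStarAlgebra (R : realType) A
    of GRing.Algebra R[i] A := {
  star : A -> A ;
  starK : involutive star ;
  starD : {morph star : a b / a + b} ;
  starZ : forall (c : R[i]) (a : A), star (c *: a) = c^* *: star a ;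
  starM : forall a b : A, star (a * b) = star b * star a
}.

#[short(type="starAlgType")]
HB.structure Definition StarAlgebra (R : realType) :=
  {A of Algebra_isStarAlgebra R A & GRing.Algebra R[i] A}.

(* The algebra A(S_q^{2n+1}) is the quotient of the *-polynomial expressions
   in n+1 generators by the congruence generated by the axioms of unital complex
   *-algebras and the defining relations.  Indices start at 0, so [QSGen i] is
   the generator usually written x_{i+1}, while
   [qs_sum i] = s_i = x_1^* x_1 + ... + x_i^* x_i in the usual numbering. *)
Section QuantumSphere.
Variables (R : realType) (q : R) (n : nat).

Inductive qs_expr : Type :=
| QSGen of 'I_n.+1
| QSConst of R[i]
| QSAdd of qs_expr & qs_expr
| QSMul of qs_expr & qs_expr
| QSStar of qs_expr.

Definition qs_sum (i : nat) : qs_expr :=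
  \big[QSAdd/QSConst 0]_(j < n.+1 | (j < i)%N) QSMul (QSStar (QSGen j)) (QSGen j).

Inductive qs_eq : qs_expr -> qs_expr -> Prop :=
| qs_refl a : qs_eq a a
| qs_sym a b : qs_eq a b -> qs_eq b a
| qs_trans a b c : qs_eq a b -> qs_eq b c -> qs_eq a c
| qs_congrD a a' b b' :
    qs_eq a a' -> qs_eq b b' -> qs_eq (QSAdd a b) (QSAdd a' b')
| qs_congrM a a' b b' :
    qs_eq a a' -> qs_eq b b' -> qs_eq (QSMul a b) (QSMul a' b')
| qs_congrS a a' : qs_eq a a' -> qs_eq (QSStar a) (QSStar a')
| qs_addA a b c : qs_eq (QSAdd a (QSAdd b c)) (QSAdd (QSAdd a b) c)
| qs_addC a b : qs_eq (QSAdd a b) (QSAdd b a)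
| qs_add0 a : qs_eq (QSAdd (QSConst 0) a) a
| qs_mulA a b c : qs_eq (QSMul a (QSMul b c)) (QSMul (QSMul a b) c)
| qs_mul1 a : qs_eq (QSMul (QSConst 1) a) a
| qs_mul0 a : qs_eq (QSMul (QSConst 0) a) (QSConst 0)
| qs_mulDl a b c :
    qs_eq (QSMul (QSAdd a b) c) (QSAdd (QSMul a c) (QSMul b c))
| qs_mulDr a b c :
    qs_eq (QSMul a (QSAdd b c)) (QSAdd (QSMul a b) (QSMul a c))
| qs_constD c d : qs_eq (QSConst (c + d)) (QSAdd (QSConst c) (QSConst d))
| qs_constM c d : qs_eq (QSConst (c * d)) (QSMul (QSConst c) (QSConst d))
| qs_constC c a : qs_eq (QSMul (QSConst c) a) (QSMul a (QSConst c))
| qs_starK a : qs_eq (QSStar (QSStar a)) a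
| qs_starD a b : qs_eq (QSStar (QSAdd a b)) (QSAdd (QSStar a) (QSStar b))
| qs_starM a b : qs_eq (QSStar (QSMul a b)) (QSMul (QSStar b) (QSStar a))
| qs_starC (c : R[i]) : qs_eq (QSStar (QSConst c)) (QSConst (c^*))
| qs_rel_comm (i j : 'I_n.+1) : (i < j)%N ->
    qs_eq (QSMul (QSGen i) (QSGen j))
          (QSMul (QSConst q%:C) (QSMul (QSGen j) (QSGen i)))
| qs_rel_starcomm (i j : 'I_n.+1) : i != j ->
    qs_eq (QSMul (QSStar (QSGen i)) (QSGen j))
          (QSMul (QSConst q%:C) (QSMul (QSGen j) (QSStar (QSGen i))))
| qs_rel_selfcomm (i : 'I_n.+1) :
    qs_eq (QSAdd (QSMul (QSGen i) (QSStar (QSGen i)))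
                 (QSMul (QSConst (-1)) (QSMul (QSStar (QSGen i)) (QSGen i))))
          (QSMul (QSConst (1 - q ^- 2)%:C) (qs_sum i))
| qs_rel_sphere : qs_eq (qs_sum n.+1) (QSConst 1).

HB.instance Definition _ := gen_eqMixin qs_expr.
HB.instance Definition _ := gen_choiceMixin qs_expr.

Definition qs_eqb (a b : qs_expr) : bool := `[< qs_eq a b >].

Fact qs_eqb_equiv : equiv_class_of qs_eqb.
Proof.
split.
- by move=> a; apply/asboolP; exact: qs_refl.
- move=> a b; apply/asboolP/asboolP; exact: qs_sym.
- move=> b a c /asboolP ab /asboolP bc; apply/asboolP; exact: qs_trans bc.
Qed.

Canonical qs_eqb_rel := EquivRelPack qs_eqb_equiv.

Definition qsphere : Type := {eq_quot qs_eqb_rel}.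
HB.instance Definition _ := Choice.on qsphere.

Definition qs_class (a : qs_expr) : qsphere := \pi_({eq_quot qs_eqb_rel}) a.
Definition qs_repr (a : qsphere) : qs_expr := repr (a : {eq_quot qs_eqb_rel}).

Lemma qs_classP a b : qs_class a = qs_class b <-> qs_eq a b.
Proof.
split=> [/eqP|ab].
  by rewrite /qs_class eqmodE => /asboolP.
by apply/eqP; rewrite /qs_class eqmodE; apply/asboolP.
Qed.

Lemma qs_reprK a : qs_class (qs_repr a) = a.
Proof. exact: reprK. Qed.

Lemma qs_classK a : qs_eq (qs_repr (qs_class a)) a.
Proof. by apply/qs_classP; rewrite qs_reprK. Qed.

Lemma qs_ind (P : qsphere -> Prop) :
  (forall a, P (qs_class a)) -> forall a, P a.
Proof. by move=> h a; rewrite -(qs_reprK a). Qed.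

Definition qs_add (a b : qsphere) := qs_class (QSAdd (qs_repr a) (qs_repr b)).
Definition qs_mul (a b : qsphere) := qs_class (QSMul (qs_repr a) (qs_repr b)).
Definition qs_const (c : R[i]) := qs_class (QSConst c).
Definition qs_scale (c : R[i]) (a : qsphere) := qs_mul (qs_const c) a.
Definition qs_opp (a : qsphere) := qs_scale (-1) a.
Definition qs_star (a : qsphere) := qs_class (QSStar (qs_repr a)).

Lemma qs_addE a b : qs_add (qs_class a) (qs_class b) = qs_class (QSAdd a b).
Proof. by apply/qs_classP; apply: qs_congrD; exact: qs_classK. Qed.

Lemma qs_mulE a b : qs_mul (qs_class a) (qs_class b) = qs_class (QSMul a b).
Proof. by apply/qs_classP; apply: qs_congrM; exact: qs_classK. Qed.

Lemma qs_starE a : qs_star (qs_class a) = qs_class (QSStar a).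
Proof. by apply/qs_classP; apply: qs_congrS; exact: qs_classK. Qed.

Lemma qs_addAq : associative qs_add.
Proof.
elim/qs_ind=> a; elim/qs_ind=> b; elim/qs_ind=> c.
by rewrite !qs_addE; apply/qs_classP; exact: qs_addA.
Qed.

Lemma qs_addCq : commutative qs_add.
Proof.
elim/qs_ind=> a; elim/qs_ind=> b.
by rewrite !qs_addE; apply/qs_classP; exact: qs_addC.
Qed.

Lemma qs_add0q : left_id (qs_const 0) qs_add.
Proof. by elim/qs_ind=> a; rewrite qs_addE; apply/qs_classP/qs_add0. Qed.

Lemma qs_mulAq : associative qs_mul.
Proof.
elim/qs_ind=> a; elim/qs_ind=> b; elim/qs_ind=> c.
by rewrite !qs_mulE; apply/qs_classP; exact: qs_mulA.
Qed.

Lemma qs_mul1q : left_id (qs_const 1) qs_mul.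
Proof. by elim/qs_ind=> a; rewrite qs_mulE; apply/qs_classP/qs_mul1. Qed.

Lemma qs_constCq c a : qs_mul (qs_const c) a = qs_mul a (qs_const c).
Proof. by elim/qs_ind: a => a; rewrite !qs_mulE; apply/qs_classP/qs_constC. Qed.

Lemma qs_mulq1 : right_id (qs_const 1) qs_mul.
Proof. by move=> a; rewrite -qs_constCq qs_mul1q. Qed.

Lemma qs_mulDlq : left_distributive qs_mul qs_add.
Proof.
elim/qs_ind=> a; elim/qs_ind=> b; elim/qs_ind=> c.
by rewrite !(qs_mulE, qs_addE); apply/qs_classP; exact: qs_mulDl.
Qed.

Lemma qs_mulDrq : right_distributive qs_mul qs_add.
Proof.
elim/qs_ind=> a; elim/qs_ind=> b; elim/qs_ind=> c.
by rewrite !(qs_mulE, qs_addE); apply/qs_classP; exact: qs_mulDr.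
Qed.

Lemma qs_constDq c d : qs_const (c + d) = qs_add (qs_const c) (qs_const d).
Proof. by rewrite qs_addE; apply/qs_classP; exact: qs_constD. Qed.

Lemma qs_constMq c d : qs_const (c * d) = qs_mul (qs_const c) (qs_const d).
Proof. by rewrite qs_mulE; apply/qs_classP; exact: qs_constM. Qed.

Lemma qs_addNq : left_inverse (qs_const 0) qs_opp qs_add.
Proof.
move=> a; rewrite /qs_opp /qs_scale -{2}(qs_mul1q a) -qs_mulDlq -qs_constDq.
rewrite addNr; elim/qs_ind: a => a.
by rewrite qs_mulE; apply/qs_classP; exact: qs_mul0.
Qed.

HB.instance Definition _ := GRing.isZmodule.Build qsphere
  qs_addAq qs_addCq qs_add0q qs_addNq.

(* The character x_n |-> 1, x_i |-> 0 for i < n shows that the quotient is not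
   the zero ring. *)
Fixpoint qs_char (a : qs_expr) : R[i] :=
  match a with
  | QSGen i => (i == ord_max)%:R
  | QSConst c => c
  | QSAdd a b => qs_char a + qs_char b
  | QSMul a b => qs_char a * qs_char b
  | QSStar a => (qs_char a)^*
  end.

Lemma qs_char_sum i : qs_char (qs_sum i) = (n < i)%:R.
Proof.
rewrite /qs_sum.
rewrite (big_morph qs_char (id1 := 0) (op1 := +%R)) //=.
rewrite (eq_bigr (fun j : 'I_n.+1 => (j == ord_max)%:R)); last first.
  by move=> j _; case: eqP; rewrite ?mulr0 // rmorph1 mulr1.
rewrite big_mkcond (bigD1 ord_max) //= eqxx big1 ?addr0; first by case: ifP.
by move=> j /negPf ->; case: ifP.
Qed.

Lemma qs_char_eq a b : qs_eq a b -> qs_char a = qs_char b.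
Proof.
elim=> //=.
- by move=> ? ? ? _ -> _ ->.
- by move=> ? ? ? ? _ -> _ ->.
- by move=> ? ? ? ? _ -> _ ->.
- by move=> ? ? _ ->.
- by move=> *; rewrite addrA.
- by move=> *; rewrite addrC.
- by move=> *; rewrite add0r.
- by move=> *; rewrite mulrA.
- by move=> *; rewrite mul1r.
- by move=> *; rewrite mul0r.
- by move=> *; rewrite mulrDl.
- by move=> *; rewrite mulrDr.
- by move=> *; rewrite mulrC.
- by move=> *; rewrite conjCK.
- by move=> *; rewrite rmorphD.
- by move=> *; rewrite rmorphM mulrC.
- move=> i j ij; have /negPf -> : i != ord_max.
    by rewrite -val_eqE /= neq_ltn (leq_trans ij) // -ltnS.
  by rewrite !(mul0r, mulr0).
- move=> i j ij; case: (eqVneq i ord_max) => [iE|_].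
    have /negPf -> : j != ord_max by rewrite -iE eq_sym.
    by rewrite !(mul0r, mulr0).
  by rewrite /= conjC0 !(mul0r, mulr0).
- move=> i; rewrite qs_char_sum ltnNge -ltnS ltn_ord /= mulr0 mulN1r.
  by rewrite mulrC subrr.
- by rewrite qs_char_sum ltnSn.
Qed.

Lemma qs_const1_neq0 : qs_const 1 != 0 :> qsphere.
Proof.
apply/eqP => /qs_classP /qs_char_eq /= /eqP.
by rewrite oner_eq0.
Qed.

HB.instance Definition _ := GRing.Zmodule_isNzRing.Build qsphere
  qs_mulAq qs_mul1q qs_mulq1 qs_mulDlq qs_mulDrq qs_const1_neq0.

Lemma qs_scaleA (c d : R[i]) (a : qsphere) :
  qs_scale c (qs_scale d a) = qs_scale (c * d) a.
Proof. by rewrite /qs_scale qs_constMq qs_mulAq. Qed.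

Lemma qs_scale1 : left_id 1 qs_scale.
Proof. exact: qs_mul1q. Qed.

Lemma qs_scaleDr : right_distributive qs_scale +%R.
Proof. by move=> c a b; exact: qs_mulDrq. Qed.

Lemma qs_scaleDl (a : qsphere) : {morph qs_scale^~ a : c d / c + d}.
Proof. by move=> c d; rewrite /qs_scale qs_constDq; exact: qs_mulDlq. Qed.

HB.instance Definition _ := GRing.Zmodule_isLmodule.Build R[i] qsphere
  qs_scaleA qs_scale1 qs_scaleDr qs_scaleDl.

Lemma qs_scaleAl (c : R[i]) (a b : qsphere) : c *: (a * b) = c *: a * b.
Proof. exact: qs_mulAq. Qed.

HB.instance Definition _ :=
  GRing.Lmodule_isLalgebra.Build R[i] qsphere qs_scaleAl.

Lemma qs_scaleAr (c : R[i]) (a b : qsphere) : c *: (a * b) = a * (c *: b).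
Proof.
change (qs_scale c (qs_mul a b) = qs_mul a (qs_scale c b)).
by rewrite /qs_scale !qs_mulAq qs_constCq.
Qed.

HB.instance Definition _ :=
  GRing.Lalgebra_isAlgebra.Build R[i] qsphere qs_scaleAr.

Lemma qs_starKq : involutive qs_star.
Proof. by elim/qs_ind=> a; rewrite !qs_starE; apply/qs_classP/qs_starK. Qed.

Lemma qs_starDq : {morph qs_star : a b / a + b}.
Proof.
elim/qs_ind=> a; elim/qs_ind=> b.
change (qs_star (qs_add (qs_class a) (qs_class b)) =
        qs_add (qs_star (qs_class a)) (qs_star (qs_class b))).
by rewrite !(qs_addE, qs_starE); apply/qs_classP/qs_starD.
Qed.

Lemma qs_starMq (a b : qsphere) : qs_star (a * b) = qs_star b * qs_star a.
Proof.
elim/qs_ind: a => a; elim/qs_ind: b => b.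
change (qs_star (qs_mul (qs_class a) (qs_class b)) =
        qs_mul (qs_star (qs_class b)) (qs_star (qs_class a))).
by rewrite !(qs_mulE, qs_starE); apply/qs_classP/qs_starM.
Qed.

Lemma qs_starZq (c : R[i]) (a : qsphere) :
  qs_star (c *: a) = c^* *: qs_star a.
Proof.
transitivity (qs_star (qs_const c * a)) => //.
rewrite qs_starMq [qs_star (qs_const c)]qs_starE.
transitivity (qs_const c^* * qs_star a) => //.
rewrite [RHS]qs_constCq; congr (_ * _).
by apply/qs_classP/qs_starC.
Qed.

HB.instance Definition _ := Algebra_isStarAlgebra.Build R qsphere
  qs_starKq qs_starDq qs_starZq qs_starMq.

Definition qs_gen (i : 'I_n.+1) : qsphere := qs_class (QSGen i).

Lemma qs_class_sum i :
  qs_class (qs_sum i) =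
  \sum_(j < n.+1 | (j < i)%N) star (qs_gen j) * qs_gen j.
Proof.
rewrite /qs_sum (big_morph qs_class (id1 := 0) (op1 := +%R)) //=.
- apply: eq_bigr => j _.
  by rewrite -qs_mulE -qs_starE.
- by move=> a b; rewrite -qs_addE.
Qed.

Lemma qs_gen_comm (i j : 'I_n.+1) : (i < j)%N ->
  qs_gen i * qs_gen j = q%:C *: (qs_gen j * qs_gen i).
Proof.
move=> ij; rewrite [LHS]qs_mulE [qs_gen j * _]qs_mulE [RHS]qs_mulE.
by apply/qs_classP/qs_rel_comm.
Qed.

Lemma qs_gen_starcomm (i j : 'I_n.+1) : i != j ->
  star (qs_gen i) * qs_gen j = q%:C *: (qs_gen j * star (qs_gen i)).
Proof.
move=> ij; rewrite [star (qs_gen i)]qs_starE.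
rewrite [LHS]qs_mulE [qs_gen j * _]qs_mulE [RHS]qs_mulE.
by apply/qs_classP/qs_rel_starcomm.
Qed.

Lemma qs_gen_selfcomm (i : 'I_n.+1) :
  qs_gen i * star (qs_gen i) - star (qs_gen i) * qs_gen i =
  (1 - q ^- 2)%:C *: \sum_(j < n.+1 | (j < i)%N) star (qs_gen j) * qs_gen j.
Proof.
rewrite -qs_class_sum [star (qs_gen i)]qs_starE.
rewrite [qs_gen i * _]qs_mulE [_ * qs_gen i]qs_mulE.
rewrite [- qs_class _]qs_mulE [LHS]qs_addE [RHS]qs_mulE.
by apply/qs_classP/qs_rel_selfcomm.
Qed.

Lemma qs_gen_sphere : \sum_(j < n.+1) star (qs_gen j) * qs_gen j = 1.
Proof.
transitivity (qs_class (qs_sum n.+1)).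
  by rewrite qs_class_sum; apply: eq_bigl => j; rewrite ltn_ord.
by apply/qs_classP/qs_rel_sphere.
Qed.

End QuantumSphere.

(* Following mathcomp's [{dot _ for _}], the inner product is linear in its
   first argument. *)
HB.mixin Record CompleteNormedModule_isHilbert (R : realType) H
    of CompleteNormedModule R[i] H := {
  hdot : {dot H for Num.conj} ;
  hdot_norm : forall v : H, `|v| ^+ 2 = hdot v v
}.

#[short(type="hilbertType")]
HB.structure Definition Hilbert (R : realType) :=
  {H of CompleteNormedModule_isHilbert R H & CompleteNormedModule R[i] H}.

Section HilbertOperators.
Variables (R : realType) (H : hilbertType R).
Implicit Types (S : set H) (T C : {linear H -> H}) (z : R[i]).

Definition lin_span S : set H :=
  [set v | exists2 s : seq (R[i] * H),
     (forall p, p \in s -> S p.2) & v = \sum_(p <- s) p.1 *: p.2].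

Definition orthonormal_basis (I : eqType) (e : I -> H) : Prop :=
  (forall i j, hdot (e i) (e j) = (i == j)%:R) /\ dense (lin_span (range e)).

Definition bounded_op T : Prop :=
  exists M : R, forall v, `|T v| <= M%:C * `|v|.

Definition compact_op T : Prop :=
  compact (closure (T @` [set v | `|v| <= 1])).

(* [uop v] is only meaningful for [v] in [udom]. *)
Record unbounded_op := UnboundedOp {
  udom : set H ;
  uop :> H -> H ;
  udom0 : udom 0 ;
  udom_lin : forall z u v, udom u -> udom v -> udom (z *: u + v) ;
  uop_lin : forall z u v, udom u -> udom v ->
    uop (z *: u + v) = z *: uop u + uop v
}.

Implicit Type D : unbounded_op.

(* The left-hand side of the equivalence says that (u, w) belongs to the graph
   of the adjoint of D. *)
Definition self_adjoint D : Prop :=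
  dense (udom D) /\
  forall u w, (forall v, udom D v -> hdot (D v) u = hdot v w) <->
              (udom D u /\ D u = w).

Definition commutator_on S D T C : Prop :=
  forall v, S v -> [/\ udom D v, udom D (T v) & D (T v) - T (D v) = C v].

Definition eigenspace_op D z : set H := [set v | udom D v /\ D v = z *: v].

Definition eigenvalue_op D z : Prop := exists2 v, eigenspace_op D z v & v != 0.

Definition infinite_dim S : Prop :=
  ~ exists s : seq H, S `<=` lin_span [set` s].

Definition is_resolvent D z T : Prop :=
  [/\ bounded_op T,
      forall v, udom D (T v) /\ D (T v) - z *: T v = v
    & forall v, udom D v -> T (D v - z *: v) = v].

Definition has_compact_resolvent D : Prop :=
  exists z T, is_resolvent D z T /\ compact_op T.

End HilbertOperators.

Section Representations.
Variables (R : realType) (A : starAlgType R) (H : hilbertType R).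

Definition star_rep (psi : A -> {linear H -> H}) : Prop :=
  (forall a, bounded_op (psi a)) /\
  [/\ forall v, psi 1 v = v,
      forall z a b v, psi (z *: a + b) v = z *: psi a v + psi b v,
      forall a b v, psi (a * b) v = psi a (psi b v)
    & forall a u v, hdot (psi (star a) u) v = hdot u (psi a v)].

End Representations.

(* The circle is parametrised by angle and carries the normalised arc length. *)
Section Circle.
Variable R : realType.

Definition circle_pt (t : R) : R[i] := cos t +i* sin t.

Definition angles : set R := `[0, 2 * pi]%classic.

Definition circle_ae (P : R[i] -> Prop) : Prop :=
  {ae lebesgue_measure, forall t : R, angles t -> P (circle_pt t)}.

Definition circle_measurable (F : R[i] -> R[i]) : Prop :=
  measurable_fun angles (fun t => complex.Re (F (circle_pt t))) /\
  measurable_fun angles (fun t => complex.Im (F (circle_pt t))).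

Definition circle_integral (F : R[i] -> R[i]) : R[i] :=
  ((2 * pi)^-1)%:C *
  (Rintegral lebesgue_measure angles (fun t => complex.Re (F (circle_pt t))) +i*
   Rintegral lebesgue_measure angles (fun t => complex.Im (F (circle_pt t)))).

End Circle.

(* Direct integrals over the circle of a constant field of Hilbert spaces K.
   [sec] picks, for each vector of H, a representative of its a.e.-class of
   square-integrable sections; this makes H the Hilbert space
   L^2(S^1; K) = L^2(S^1) (x) K.  Weak measurability is the right notion for
   separable K. *)
Section DirectIntegral.
Variables (R : realType) (K H : hilbertType R).

Definition square_integrable_section (F : R[i] -> K) : Prop :=
  (forall v : K, circle_measurable (fun l => hdot (F l) v)) /\
  lebesgue_measure.-integrable (@angles R)
    (fun t => (complex.Re (`|F (circle_pt t)| ^+ 2))%:E).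

Definition is_direct_integral_space (sec : H -> R[i] -> K) : Prop :=
  [/\ forall xi, square_integrable_section (sec xi),
      forall z xi eta, circle_ae
        (fun l => sec (z *: xi + eta) l = z *: sec xi l + sec eta l),
      forall xi eta,
        hdot xi eta = circle_integral (fun l => hdot (sec xi l) (sec eta l))
    & forall F, square_integrable_section F ->
        exists xi, circle_ae (fun l => sec xi l = F l)].

Definition is_direct_integral_rep (A : Type) (sec : H -> R[i] -> K)
    (psi_ : R[i] -> A -> {linear K -> K}) (psi : A -> {linear H -> H}) : Prop :=
  forall a xi, circle_ae (fun l => sec (psi a xi) l = psi_ l a (sec xi l)).

Definition is_fourier_basis (I : Type) (sec : H -> R[i] -> K)
    (f : I -> K) (e : int * I -> H) : Prop :=
  forall k0 k, circle_ae (fun l => sec (e (k0, k)) l = l ^ k0 *: f k).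

End DirectIntegral.

(* [k j] stands for k_{j+1} in |k_1, ..., k_n>. *)
Section IrreducibleRep.
Variables (R : realType) (q : R) (n : nat) (K : hilbertType R).

Definition lower (k : {ffun 'I_n -> nat}) (j : 'I_n) : {ffun 'I_n -> nat} :=
  [ffun l => if l == j then (k l).-1 else k l].

(* [qs_gen q (lift ord0 j)] is x_i for i = j + 2, so that k_{i-1} is [k j] and
   k_i + ... + k_n is the sum of the [k l] with j < l. *)
Definition is_psi_lambda (f : {ffun 'I_n -> nat} -> K) (lambda : R[i])
    (psi : qsphere q n -> {linear K -> K}) : Prop :=
  [/\ star_rep psi,
      forall k, psi (qs_gen q ord0) (f k) =
        (lambda * (q ^- (\sum_(l < n) k l))%:C) *: f k
    & forall (j : 'I_n) k, psi (qs_gen q (lift ord0 j)) (f k) =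
        (Num.sqrt (1 - q ^- (2 * k j)) *
         q ^- (\sum_(l < n | (j < l)%N) k l))%:C *: f (lower k j)].

End IrreducibleRep.

(* Main.v *)
Require Import Defs.
From HB Require Import structures.
From mathcomp Require Import all_boot all_order all_algebra complex.
From mathcomp Require Import all_classical all_reals all_analysis.

Import Order.TTheory GRing.Theory Num.Theory.
Import numFieldNormedType.Exports.

Local Open Scope complex_scope.
Local Open Scope classical_set_scope.
Local Open Scope ring_scope.

Set Implicit Arguments.
Unset Strict Implicit.
Unset Printing Implicit Defensive.

(* A generator x_i sends each vector |k_0,...,k_n> to a multiple of a basis
   vector and shifts k_0 by a fixed weight: 1 for x_1 and 0 for i > 1; a matrix
   coefficient computation gives the opposite weight for x_i^*.  An operator T of
   weight m satisfies [D, T] = m T on the span of the basis, so by the Leibniz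
   rule [D, psi(a)] lies in the image of psi for every a, hence is bounded.
   For n > 0 each eigenspace contains the infinite orthonormal family obtained
   by varying (k_1,...,k_n); on such a family a resolvent acts as a nonzero
   scalar, so it is not compact. *)

(** * Spans, orthonormal families and unbounded operators in a Hilbert space *)

Section HilbertSpace.
Variables (R : realType) (H : hilbertType R).
Implicit Types (S : set H) (u v : H) (T C : {linear H -> H}).

Lemma hdotZr (b : R[i]) u v : hdot u (b *: v) = Num.conj b * hdot u v.
Proof. by rewrite linearZr_LR. Qed.

Lemma hdotZl (a : R[i]) u v : hdot (a *: u) v = a * hdot u v.
Proof. by rewrite linearZl_LR. Qed.

Lemma hdotC u v : hdot u v = Num.conj (hdot v u).
Proof. by rewrite hermC expr0 mul1r. Qed.

Lemma lin_span_incl S v : S v -> lin_span S v.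
Proof.
move=> Sv; exists [:: (1, v)]; last by rewrite big_seq1 scale1r.
by move=> p; rewrite inE => /eqP ->.
Qed.

Lemma lin_span0 S : lin_span S 0.
Proof. by exists [::] => //; rewrite big_nil. Qed.

Lemma lin_span_lin S (z : R[i]) u v :
  lin_span S u -> lin_span S v -> lin_span S (z *: u + v).
Proof.
move=> [s sS ->] [t tS ->].
exists ([seq (z * p.1, p.2) | p <- s] ++ t).
  by move=> p; rewrite mem_cat => /orP[/mapP[p' /sS ? ->]|/tS].
rewrite big_cat big_map /= scaler_sumr; congr (_ + _).
by apply: eq_bigr => p _; rewrite scalerA.
Qed.

Lemma lin_span_ind S (P : H -> Prop) : P 0 ->
  (forall z u v, S u -> P v -> P (z *: u + v)) ->
  forall v, lin_span S v -> P v.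
Proof.
move=> P0 Plin _ [s sS ->]; elim: s sS => [|p s IHs] sS; first by rewrite big_nil.
rewrite big_cons; apply: Plin; first by apply: sS; rewrite mem_head.
by apply: IHs => p' p's; apply: sS; rewrite in_cons p's orbT.
Qed.

(** If [v] were nonzero, density would give [s] in [S] with [|v - s| < |v|], whereas orthogonality
    makes the square of the left side equal to [|v| ^+ 2 + |s| ^+ 2]. *)
Lemma orth_dense_eq0 S v : dense S -> (forall s, S s -> hdot v s = 0) -> v = 0.
Proof.
move=> dS vS; apply/eqP/negPn/negP => v0.
have nv0 : 0 < `|v| by rewrite normr_gt0.
have [s [vs Ss]] : ball v `|v| `&` S !=set0.
  apply: dS; last exact: ball_open.
  by exists v; exact: ballxx.
move: vs; rewrite -ball_normE /ball_ /= => vs.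
have : `|v - s| ^+ 2 < `|v| ^+ 2 by rewrite ltr_pXn2r ?nnegrE.
have sv : hdot s v = 0 by rewrite hdotC vS // conjC0.
rewrite !hdot_norm linearBl /= !linearBr /= (vS s Ss) sv.
rewrite subr0 sub0r opprK gtrDl -hdot_norm.
by rewrite real_ltNge ?realE ?exprn_ge0 ?lexx.
Qed.

Lemma hdot_basis_inj (I : eqType) (e : I -> H) u v : orthonormal_basis e ->
  (forall i, hdot u (e i) = hdot v (e i)) -> u = v.
Proof.
move=> [_ de] uv; apply/eqP; rewrite -subr_eq0; apply/eqP.
apply: (orth_dense_eq0 de); apply: lin_span_ind.
  by rewrite linear0r.
move=> z _ w [i _ <-] IH.
by rewrite linearDr /= IH addr0 hdotZr linearBl /= uv subrr mulr0.
Qed.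

(** Dimension count: the coordinates over [s] of the first [(size s).+1] vectors form a matrix with
    more rows than columns. A nonzero row in its left kernel is a linear relation between
    orthonormal vectors. *)
Lemma infinite_dim_orthonormal S (e : nat -> H) :
  (forall i j, hdot (e i) (e j) = (i == j)%:R) -> (forall i, S (e i)) ->
  infinite_dim S.
Proof.
move=> on Se [s sS].
have coef v : lin_span [set` s] v ->
    exists c : 'rV[R[i]]_(size s), v = \sum_j c 0 j *: s`_j.
  move: v; apply: lin_span_ind.
    by exists 0; rewrite big1 // => j _; rewrite mxE scale0r.
  move=> z u v us [c ->].
  have us' : (index u s < size s)%N by rewrite index_mem.
  (* [s] may contain repetitions; the new coefficient goes to the first occurrence of [u]. *)
  exists (z *: delta_mx 0 (Ordinal us') + c).
  under [RHS]eq_bigr => j _ do rewrite !mxE scalerDl.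
  rewrite big_split /= [X in _ = X + _](bigD1 (Ordinal us')) //= eqxx mulr1 nth_index //.
  congr (_ + _); rewrite big1 ?addr0 // => j /negPf jn.
  by rewrite jn mulr0 scale0r.
pose A := \matrix_(i < (size s).+1) sval (cid (coef _ (sS _ (Se i)))).
have AE (i : 'I_(size s).+1) : e i = \sum_j A i j *: s`_j.
  rewrite [LHS](svalP (cid (coef _ (sS _ (Se i))))).
  by apply: eq_bigr => j _; rewrite mxE.
have : kermx A != 0.
  rewrite kermx_eq0 /row_free neq_ltn; apply/orP; left.
  by rewrite ltnS rank_leq_col.
case/rowV0Pn => x /sub_kermxP xA /negP; apply; apply/eqP/rowP => i; rewrite mxE.
have : \sum_(i < (size s).+1) x 0 i *: e i = 0.
  under eq_bigr => k _ do rewrite AE scaler_sumr.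
  rewrite exchange_big /= big1 // => j _.
  under eq_bigr => k _ do rewrite scalerA.
  rewrite -scaler_suml; move/rowP: xA => /(_ j); rewrite !mxE => ->.
  by rewrite scale0r.
move=> /(congr1 (fun v => hdot v (e i))); rewrite linear0l linear_sumlz /=.
rewrite (bigD1 i) //= hdotZl on eqxx mulr1 big1 ?addr0 // => j ji.
by rewrite hdotZl on -val_eqE in ji *; rewrite (negPf ji) mulr0.
Qed.

(** Distinct vectors [c *: e i] have squared distance [2 * |c| ^+ 2], so a sequence of them in the
    image of the unit ball has no cluster point. *)
Lemma scaling_orthonormal_not_compact T (e : nat -> H) (c : R[i]) :
  (forall i j, hdot (e i) (e j) = (i == j)%:R) -> c != 0 ->
  (forall i, T (e i) = c *: e i) -> ~ compact_op T.
Proof.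
move=> on c0 Te cT.
have en i : `|e i| = 1.
  apply/eqP; rewrite -(@eqrXn2 _ 2) ?ler01 //.
  by rewrite hdot_norm on eqxx expr1n.
(* Compactness is applied to the filter of tails of the sequence [T (e m)], with cluster point
   [p]. *)
have [|p [_ pc]] := cT ((fun m => T (e m)) @ \oo) _.
  exists 0%N => // m _ /=; apply: subset_closure; exists (e m) => //=.
  by rewrite en.
have c2 : 0 < `|c| / 2 by rewrite divr_gt0 // normr_gt0.
have near m0 : exists2 m, (m0 <= m)%N & ball p (`|c| / 2) (T (e m)).
  have [||w [[m /= m0m <-] pw]] :=
    pc [set T (e m) | m in [set m | (m0 <= m)%N]] (ball p (`|c| / 2)).
  - by exists m0 => // m /= m0m; exists m.
  - exact: nbhsx_ballx.
  - by exists m.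
have [m1 _ b1] := near 0%N.
have [m2 m12 b2] := near m1.+1.
(* Two images within [|c| / 2] of [p] are less than [|c|] apart; dividing by [|c|] puts [e m1] and
   [e m2] at distance below 1, while their squared distance is [1 + 1]. *)
have := ball_splitr b1 b2.
rewrite -ball_normE /ball_ /= !Te -scalerBr normrZ gtr_pMr ?normr_gt0 // => lt1.
have : `|e m1 - e m2| ^+ 2 < 1 by rewrite expr_lt1.
rewrite hdot_norm linearBl /= !linearBr /= !on !eqxx (gtn_eqF m12) (ltn_eqF m12).
rewrite subr0 sub0r opprK gtrDl.
by rewrite ltr10.
Qed.

Lemma uop0 (D : unbounded_op H) : D 0 = 0.
Proof.
have := uop_lin (-1) (udom0 D) (udom0 D).
by rewrite scaleN1r oppr0 addr0 scaleN1r addNr.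
Qed.

Lemma uopZ (D : unbounded_op H) (z : R[i]) v :
  udom D v -> udom D (z *: v) /\ D (z *: v) = z *: D v.
Proof.
move=> Dv; rewrite -[z *: v]addr0; split; first exact/udom_lin/udom0.
by rewrite uop_lin ?uop0 ?addr0//; exact: udom0.
Qed.

Lemma self_adjoint_sym (D : unbounded_op H) u v : self_adjoint D ->
  udom D u -> udom D v -> hdot (D v) u = hdot v (D u).
Proof. by move=> [_ Dsym] Du; apply: (Dsym u (D u)).2. Qed.

Lemma commutator_on_span S (D : unbounded_op H) T C :
  commutator_on S D T C -> commutator_on (lin_span S) D T C.
Proof.
move=> h; apply: lin_span_ind.
  rewrite !linear0; split; [exact: udom0|exact: udom0|].
  by rewrite uop0 linear0 subrr.
move=> z u v /h[u1 u2 u3] [v1 v2 v3]; split.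
- exact: udom_lin.
- by rewrite linearP; exact: udom_lin.
- by rewrite !linearP /= !uop_lin // linearP -u3 -v3 scalerBr opprD addrACA.
Qed.

(* [t] inverts [s] only where the weight [c] does not vanish: lowering operators
   annihilate the basis vectors that they cannot lower. *)
Lemma adjoint_weighted_shift (I : eqType) (e : I -> H) T C
    (s t : I -> I) (c : I -> R[i]) :
  orthonormal_basis e -> (forall u v, hdot (C u) v = hdot u (T v)) ->
  (forall i, T (e i) = c i *: e (s i)) ->
  (forall i j, c i != 0 -> (j == s i) = (t j == i)) ->
  forall j, C (e j) = Num.conj (c (t j)) *: e (t j).
Proof.
move=> oe CT Te st j; apply: (hdot_basis_inj oe) => i.
rewrite CT Te hdotZr hdotZl !oe.1.
have [c0|c0] := eqVneq (c i) 0; last first.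
  by rewrite st //; case: eqVneq => [->|] //; rewrite !mulr0.
(* With [c i = 0] the left side vanishes; the right side can be nonzero only for [t j = i], where
   its coefficient is the conjugate of [c i]. *)
by rewrite c0 conjC0 mul0r; case: eqVneq => [->|]; rewrite ?c0 ?conjC0 ?mul0r ?mulr0.
Qed.

End HilbertSpace.

(** * Reduction of identities in the direct integral to identities on the fibres *)

Section DirectIntegralSpace.
Variables (R : realType) (K H : hilbertType R) (sec : H -> R[i] -> K).
Hypothesis hsec : is_direct_integral_space sec.

Lemma norm_circle_pt (t : R) : `|circle_pt t| = 1.
Proof. by rewrite normc_def /= cos2Dsin2 sqrtr1. Qed.

Lemma circle_aeS (P Q : R[i] -> Prop) :
  (forall l, `|l| = 1 -> P l -> Q l) -> circle_ae P -> circle_ae Q.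
Proof.
move=> PQ; apply: (@filterS _ _ (ae_filter_ringOfSetsType (@lebesgue_measure R))).
move=> t Pt at_; apply: PQ (Pt at_).
exact: norm_circle_pt.
Qed.

Lemma circle_aeI (P Q : R[i] -> Prop) :
  circle_ae P -> circle_ae Q -> circle_ae (fun l => P l /\ Q l).
Proof.
apply: (@filterS2 _ _ (ae_filter_ringOfSetsType (@lebesgue_measure R))).
by move=> t Pt Qt at_; split; [exact: Pt|exact: Qt].
Qed.

Lemma Rintegral_ae_eq0 (D : set R) (g : R -> R) : measurable D ->
  lebesgue_measure.-integrable D (EFin \o g) ->
  {ae lebesgue_measure, forall t, D t -> g t = 0} ->
  Rintegral lebesgue_measure D g = 0.
Proof.
move=> mD /measurable_int mg g0; rewrite /Rintegral.
rewrite (@ae_eq_integral _ _ _ _ _ (cst 0%E)) ?integral0 //.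
apply: (@filterS _ _ (ae_filter_ringOfSetsType (@lebesgue_measure R))) g0.
by move=> t gt Dt /=; rewrite gt.
Qed.

(** The squared norm of the difference [d] is the circle integral of the squared fibre norms, which
    vanish almost everywhere. *)
Lemma sec_inj xi eta : circle_ae (fun l => sec xi l = sec eta l) -> xi = eta.
Proof.
case: hsec => sq lin dot _ xe.
pose d := (-1) *: eta + xi.
have d0 : circle_ae (fun l => sec d l = 0).
  apply: circle_aeS (circle_aeI xe (lin (-1) eta xi)) => l _ [-> ->].
  by rewrite scaleN1r addNr.
suff : d = 0 by rewrite /d scaleN1r addrC => /subr0_eq.
(* Norms are complex numbers here; since they are real, the imaginary part of the integrand is
   identically zero. *)
have dE (v : K) : hdot v v = (complex.Re (`|v| ^+ 2))%:C.
  have vR : hdot v v \is Num.real by rewrite -hdot_norm rpredX // normr_real.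
  by rewrite hdot_norm RRe_real.
apply/eqP; rewrite -normr_eq0 -sqrf_eq0 hdot_norm dot /circle_integral.
have -> : (fun t => complex.Re (hdot (sec d (circle_pt t)) (sec d (circle_pt t)))) =
    (fun t => complex.Re (`|sec d (circle_pt t)| ^+ 2)).
  by apply/funext => t; rewrite dE.
have -> : (fun t => complex.Im (hdot (sec d (circle_pt t)) (sec d (circle_pt t)))) =
    cst 0.
  by apply/funext => t; rewrite dE.
have mA : measurable (@angles R) by exact: measurable_itv.
rewrite !Rintegral_ae_eq0 ?mulr0 //.
- exact: integrable0.
- exact: (@filterE _ _ (ae_filter_ringOfSetsType (@lebesgue_measure R))).
- exact: (sq d).2.
- apply: (@filterS _ _ (ae_filter_ringOfSetsType (@lebesgue_measure R))) d0.
  by move=> t dt at_; rewrite dt // normr0 expr0n.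
Qed.

Lemma sec_scale (z : R[i]) xi :
  circle_ae (fun l => sec (z *: xi) l = z *: sec xi l).
Proof.
case: hsec => _ lin _ _.
(* The first instance leaves a term [sec 0 l]; the second, whose right side cancels, shows that this
   term is 0 almost everywhere. *)
have := circle_aeI (lin z xi 0) (lin (-1) 0 0).
apply: circle_aeS => l _; rewrite !addr0 scaler0 => -[-> ->].
by rewrite scaleN1r addNr addr0.
Qed.

(** By injectivity of [sec] up to null sets, the action on a Fourier vector can be checked fibre by
    fibre, at unit [l] only. *)
Lemma direct_integral_rep_fourier (A I : Type) (f : I -> K) (e : int * I -> H)
    (psi_ : R[i] -> A -> {linear K -> K}) (psi : A -> {linear H -> H})
    (a : A) (c : R[i]) (k0 k0' : int) (k k' : I) :
  is_fourier_basis sec f e -> is_direct_integral_rep sec psi_ psi ->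
  (forall l, `|l| = 1 -> psi_ l a (l ^ k0 *: f k) = c *: (l ^ k0' *: f k')) ->
  psi a (e (k0, k)) = c *: e (k0', k').
Proof.
move=> fe ipsi al; apply: sec_inj.
have := circle_aeI (circle_aeI (ipsi a (e (k0, k))) (sec_scale c (e (k0', k'))))
  (circle_aeI (fe k0 k) (fe k0' k')).
by apply: circle_aeS => l l1 [[-> ->] [-> ->]]; exact: al.
Qed.

End DirectIntegralSpace.

(** * Induction on the quantum sphere algebra *)

Section QuantumSphereAlgebra.
Variables (R : realType) (q : R) (n : nat).

Lemma qs_const_scale (c : R[i]) : qs_class q (QSConst n c) = c *: 1.
Proof. by symmetry; exact: mulr1. Qed.

(** Closure under [star] is not among the premises: the induction on expressions carries [P] for a
    class and for its star together, which pushes stars down to the generators. *)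
Lemma qsphere_ind (P : qsphere q n -> Prop) :
  (forall i, P (qs_gen q i)) -> (forall i, P (star (qs_gen q i))) -> P 1 ->
  (forall z a b, P a -> P b -> P (z *: a + b)) ->
  (forall a b, P a -> P b -> P (a * b)) ->
  forall a, P a.
Proof.
move=> Pg Ps P1 Plin PM.
have P0 : P 0 by rewrite -(addNr (1 : qsphere q n)) -scaleN1r; exact: Plin.
have PC c : P (qs_class q (QSConst n c)).
  by rewrite qs_const_scale -[_ *: _]addr0; exact: Plin.
have PD a b : P a -> P b -> P (a + b) by rewrite -{2}[a]scale1r; exact: Plin.
apply: qs_ind => a; suff [] : P (qs_class q a) /\ P (star (qs_class q a)) by [].
have ME x y : qs_class q (QSMul x y) = qs_class q x * qs_class q y.
  by rewrite [RHS]qs_mulE.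
have DE x y : qs_class q (QSAdd x y) = qs_class q x + qs_class q y.
  by rewrite [RHS]qs_addE.
elim: a => [i|c|a [Pa Pa'] b [Pb Pb']|a [Pa Pa'] b [Pb Pb']|a [Pa Pa']].
- by split; [exact: Pg|exact: Ps].
- split; first exact: PC.
  by rewrite [star _]qs_starE; have /qs_classP -> := qs_starC q n c; exact: PC.
- by rewrite DE starD; split; exact: PD.
- by rewrite ME starM; split; exact: PM.
- have -> : qs_class q (QSStar a) = star (qs_class q a) by rewrite [RHS]qs_starE.
  by rewrite starK.
Qed.

End QuantumSphereAlgebra.

(** * Stability of the commutator property under the algebra operations *)

Section CommutatorInRep.
Variables (R : realType) (A : starAlgType R) (H : hilbertType R).
Variables (psi : A -> {linear H -> H}) (D : unbounded_op H) (V : set H).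
Hypothesis hpsi : star_rep psi.

(* Asking the commutator to be some [psi b], rather than merely bounded, is what
   makes the property stable under products. *)
Definition commutator_in_rep (a : A) : Prop :=
  (forall v, V v -> V (psi a v)) /\ exists b, commutator_on V D (psi a) (psi b).

Let rep1 v : psi 1 v = v. Proof. by case: hpsi => _ []. Qed.
Let replin z a b v : psi (z *: a + b) v = z *: psi a v + psi b v.
Proof. by case: hpsi => _ []. Qed.
Let repM a b v : psi (a * b) v = psi a (psi b v).
Proof. by case: hpsi => _ []. Qed.

Lemma commutator_in_rep1 : V `<=` udom D -> commutator_in_rep 1.
Proof.
move=> VD; split=> [v|]; first by rewrite rep1.
exists 0 => v /VD Dv; rewrite !rep1; split=> //.
(* Linearity of [psi] at [(-1) *: 1 + 1] yields [psi 0 v = 0]. *)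
by have := replin (-1) 1 1 v; rewrite !scaleN1r !addNr subrr => ->.
Qed.

Lemma commutator_in_rep_lin z a b :
  (forall z u v, V u -> V v -> V (z *: u + v)) ->
  commutator_in_rep a -> commutator_in_rep b -> commutator_in_rep (z *: a + b).
Proof.
move=> Vlin [Va [a' aa']] [Vb [b' bb']]; split=> [v Vv|].
  by rewrite replin; apply: Vlin; [exact: Va|exact: Vb].
exists (z *: a' + b') => v Vv.
have [Dv Dav av] := aa' v Vv; have [_ Dbv bv] := bb' v Vv.
rewrite !replin; split=> //; first exact: udom_lin.
by rewrite uop_lin // -av -bv scalerBr opprD addrACA.
Qed.

(** Leibniz rule: the commutator with the product is [a' * b + a * b']. Stability of [V] under
    [psi b] is what allows the commutator of [psi a] to be evaluated at [psi b v]. *)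
Lemma commutator_in_repM a b :
  commutator_in_rep a -> commutator_in_rep b -> commutator_in_rep (a * b).
Proof.
move=> [Va [a' aa']] [Vb [b' bb']]; split=> [v Vv|].
  by rewrite repM; exact/Va/Vb.
exists (1 *: (a' * b) + a * b') => v Vv.
have [Dv Dbv bv] := bb' v Vv; have [_ Dav av] := aa' _ (Vb v Vv).
rewrite replin !repM scale1r; split=> //.
by rewrite -av -bv linearB /= addrA subrK.
Qed.

End CommutatorInRep.

(** On a basis vector, [D T] contributes the factor [k0 + m] and [T D] the factor [k0]; their
    difference is [m], and linearity extends this to the span. *)
Lemma weight_commutator (R : realType) (H : hilbertType R) (I : Type)
    (e : int * I -> H) (D : unbounded_op H) (T C : {linear H -> H}) (m : int) :
  (forall k0 k, udom D (e (k0, k)) /\ D (e (k0, k)) = k0%:~R *: e (k0, k)) ->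
  (forall k0 k, exists c k', T (e (k0, k)) = c *: e (k0 + m, k')) ->
  (forall v, C v = m%:~R *: T v) ->
  commutator_on (lin_span (range e)) D T C.
Proof.
move=> De Te CE; apply: commutator_on_span => _ [[k0 k] _ <-].
have [c [k' Tk]] := Te k0 k; have [D1 D2] := De k0 k; have [D3 D4] := De (k0 + m) k'.
have [D5 D6] := uopZ c D3.
rewrite CE Tk; split=> //.
have TZ : T (k0%:~R *: e (k0, k)) = k0%:~R *: (c *: e (k0 + m, k')).
  by rewrite linearZ /= Tk.
rewrite D6 D4 D2 TZ !scalerA -scalerBl; congr (_ *: _).
by rewrite intrD mulrDr [c * k0%:~R]mulrC addrAC subrr add0r mulrC.
Qed.

Lemma weight_stable (R : realType) (H : hilbertType R) (I : Type)
    (e : I -> H) (T : {linear H -> H}) :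
  (forall i, exists c j, T (e i) = c *: e j) ->
  forall v, lin_span (range e) v -> lin_span (range e) (T v).
Proof.
move=> Te; apply: lin_span_ind; first by rewrite linear0; exact: lin_span0.
move=> z _ v [i _ <-] IH; rewrite linearP; apply: lin_span_lin => //.
have [c [j ->]] := Te i; rewrite -[_ *: _]addr0; apply: lin_span_lin.
  by apply: lin_span_incl; exists j.
exact: lin_span0.
Qed.
(** An eigenvector has a nonzero coefficient along some [e i]. Moving [D] across the inner product,
    with [d i] real, shows that this coefficient is multiplied equally by [mu] and by [d i]. *)
Lemma diagonal_eigenvalue (R : realType) (H : hilbertType R) (I : eqType)
    (e : I -> H) (d : I -> R[i]) (D : unbounded_op H) (mu : R[i]) :
  orthonormal_basis e -> self_adjoint D ->
  (forall i, udom D (e i) /\ D (e i) = d i *: e i) ->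
  (forall i, d i \is Num.real) ->
  eigenvalue_op D mu -> exists i, mu = d i.
Proof.
move=> oe sD De dR [v [vD Dv] /eqP v0].
have /existsNP[i /eqP ei] : ~ forall i, hdot v (e i) = 0.
  by move=> ve; apply/v0/(hdot_basis_inj oe) => i; rewrite ve linear0l.
exists i; apply: (mulIf ei).
have := self_adjoint_sym sD (De i).1 vD.
by rewrite Dv (De i).2 hdotZl hdotZr (CrealP (dR i)).
Qed.

(** * Multiplicity of the eigenvalues and failure of compact resolvent *)

Section FourierBasis.
Variables (R : realType) (n : nat) (H : hilbertType R).
Variables (e : int * {ffun 'I_n -> nat} -> H) (D : unbounded_op H).
Hypothesis he : orthonormal_basis e.
Hypothesis hDe : forall k0 k, udom D (e (k0, k)) /\
  D (e (k0, k)) = k0%:~R *: e (k0, k).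
Hypothesis n_gt0 : (0 < n)%N.

(** Constant multi-indices suffice for an infinite family with fixed [k0]; they are distinct for
    distinct [m] because [n] is positive. *)
Let diag k0 m := e (k0, [ffun=> m]).

Let diag_orthonormal k0 i j : hdot (diag k0 i) (diag k0 j) = (i == j)%:R.
Proof.
rewrite he.1 xpair_eqE eqxx; congr (nat_of_bool _)%:R.
apply/eqP/eqP => [/ffunP/(_ (Ordinal n_gt0))|->//].
by rewrite !ffunE.
Qed.

Lemma fourier_eigenspace_infinite mu : self_adjoint D ->
  eigenvalue_op D mu -> infinite_dim (eigenspace_op D mu).
Proof.
move=> sD emu.
have [||[k0 k] /= ->] := diagonal_eigenvalue (d := fun p => p.1%:~R) he sD _ _ emu.
- by case=> k0 k; exact: hDe.
- by move=> p; rewrite realz.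
- by apply: infinite_dim_orthonormal (diag_orthonormal k0) _ => m; exact: hDe.
Qed.

(** The vectors [diag 0 m] lie in the kernel of [D], so a resolvent at [z] multiplies each of them
    by [- z^-1]. *)
Lemma fourier_resolvent_not_compact : ~ has_compact_resolvent D.
Proof.
move=> [z [T [[_ Tr Tl] cT]]].
have Te m : T (diag 0 m) = - z^-1 *: diag 0 m /\ z != 0.
  have [Dm Dm0] := hDe 0 [ffun=> m].
  have := Tl _ Dm; rewrite Dm0 scale0r sub0r linearN linearZ /= => zT.
  (* If [z = 0], the resolvent identity on the kernel of [D] would make a unit vector zero. *)
  have z0 : z != 0.
    apply/eqP => z0; have := diag_orthonormal 0 m m.
    rewrite /diag -zT z0 scale0r oppr0 linear0r eqxx => /eqP.
    by rewrite eq_sym oner_eq0.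
  rewrite /diag; split=> //.
  by rewrite -[in RHS]zT scalerN scaleNr opprK scalerA mulVf // scale1r.
apply: (@scaling_orthonormal_not_compact _ _ T (diag 0) (- z^-1)) cT.
- exact: diag_orthonormal.
- by rewrite oppr_eq0 invr_eq0; exact: (Te 0%N).2.
- by move=> m; exact: (Te m).1.
Qed.

End FourierBasis.

(** * Action of the generators and their adjoints on the Fourier basis *)

Section GeneratorAction.
Variables (R : realType) (q : R) (n : nat) (K H : hilbertType R).
Variables (f : {ffun 'I_n -> nat} -> K) (psi_ : R[i] -> qsphere q n -> {linear K -> K}).
Hypothesis hpsi_ : forall lambda : R[i], `|lambda| = 1 ->
  is_psi_lambda f lambda (psi_ lambda).
Variables (sec : H -> R[i] -> K) (e : int * {ffun 'I_n -> nat} -> H).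
Hypotheses (hsec : is_direct_integral_space sec) (he : orthonormal_basis e).
Hypothesis he_fourier : is_fourier_basis sec f e.
Variable psi : qsphere q n -> {linear H -> H}.
Hypotheses (hpsi : star_rep psi) (hpsi_int : is_direct_integral_rep sec psi_ psi).

Definition raise (k : {ffun 'I_n -> nat}) (j : 'I_n) : {ffun 'I_n -> nat} :=
  [ffun l => if l == j then (k l).+1 else k l].

(** The predecessor in [lower] truncates at 0, so [raise] undoes [lower] only where [k j] is
    positive. *)
Lemma lower_raise (k k' : {ffun 'I_n -> nat}) j : k j != 0%N ->
  (k' == lower k j) = (raise k' j == k).
Proof.
move=> kj; apply/eqP/eqP => [->|<-]; apply/ffunP => l; rewrite !ffunE.
  by case: eqP => // ->; rewrite prednK // lt0n.
by case: eqP.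
Qed.

Let c0 (k : {ffun 'I_n -> nat}) : R[i] := (q ^- (\sum_(l < n) k l))%:C.
Let c1 (j : 'I_n) (k : {ffun 'I_n -> nat}) : R[i] :=
  (Num.sqrt (1 - q ^- (2 * k j)) * q ^- (\sum_(l < n | (j < l)%N) k l))%:C.

Lemma psi_gen0 k0 k : psi (qs_gen q ord0) (e (k0, k)) = c0 k *: e (k0 + 1, k).
Proof.
apply: (direct_integral_rep_fourier hsec he_fourier hpsi_int) => l l1.
rewrite linearZ /=.
(* The exponent [k0] may be negative, so adding exponents requires [l] to be invertible. *)
have l0 : l != 0 by rewrite -normr_eq0 l1 oner_eq0.
have [_ gen0 _] := hpsi_ l1.
by rewrite gen0 !scalerA expfzDr // expr1z mulrA mulrC.
Qed.

Lemma psi_genS j k0 k :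
  psi (qs_gen q (lift ord0 j)) (e (k0, k)) = c1 j k *: e (k0, lower k j).
Proof.
apply: (direct_integral_rep_fourier hsec he_fourier hpsi_int) => l l1.
have [_ _ genS] := hpsi_ l1.
by rewrite linearZ /= genS !scalerA mulrC.
Qed.

Let psi_adj a u v : hdot (psi (star a) u) v = hdot u (psi a v).
Proof. by case: hpsi => _ []. Qed.

Lemma psi_star_gen0 k0 k :
  psi (star (qs_gen q ord0)) (e (k0, k)) = Num.conj (c0 k) *: e (k0 - 1, k).
Proof.
apply: (adjoint_weighted_shift (T := psi (qs_gen q ord0))
  (s := fun p => (p.1 + 1, p.2)) (t := fun p => (p.1 - 1, p.2))
  (c := fun p => c0 p.2) he _ _ _ (k0, k)).
- exact: psi_adj.
- by case=> i0 i; exact: psi_gen0.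
- by case=> i0 i [j0 j] _ /=; rewrite !xpair_eqE subr_eq.
Qed.

Lemma psi_star_genS j k0 k :
  psi (star (qs_gen q (lift ord0 j))) (e (k0, k)) =
    Num.conj (c1 j (raise k j)) *: e (k0, raise k j).
Proof.
apply: (adjoint_weighted_shift (T := psi (qs_gen q (lift ord0 j)))
  (s := fun p => (p.1, lower p.2 j)) (t := fun p => (p.1, raise p.2 j))
  (c := fun p => c1 j p.2) he _ _ _ (k0, k)).
- exact: psi_adj.
- by case=> i0 i; exact: psi_genS.
- case=> i0 i [l0 l] /= c1i; rewrite !xpair_eqE lower_raise //.
  (* When [k j = 0] the factor [1 - q ^- 0] under the root is 0, so the truncated case carries
     weight zero. *)
  apply: contraNneq c1i => ij.
  by rewrite /c1 ij muln0 expr0 invr1 subrr sqrtr0 mul0r.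
Qed.

Variable D : unbounded_op H.
Hypothesis hDe : forall k0 k, udom D (e (k0, k)) /\
  D (e (k0, k)) = k0%:~R *: e (k0, k).

Local Notation V := (lin_span (range e)).

Lemma commutator_gen0 :
  commutator_on V D (psi (qs_gen q ord0)) (psi (qs_gen q ord0)).
Proof.
apply: (weight_commutator (m := 1) hDe) => [k0 k|v]; last by rewrite scale1r.
by exists (c0 k), k; exact: psi_gen0.
Qed.

Lemma commutator_genS i : i != ord0 -> commutator_on V D (psi (qs_gen q i)) \0.
Proof.
case: (unliftP ord0 i) => [j ->|->]; last by rewrite eqxx.
move=> _; apply: (weight_commutator (m := 0) hDe) => [k0 k|v]; last first.
  by rewrite scale0r.
by exists (c1 j k), (lower k j); rewrite addr0; exact: psi_genS.
Qed.

Let weight_in_rep a (m : int) :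
  (forall k0 k, exists c k', psi a (e (k0, k)) = c *: e (k0 + m, k')) ->
  commutator_in_rep psi D V a.
Proof.
move=> am; split.
  apply: weight_stable => -[k0 k]; have [c [k' ->]] := am k0 k.
  by exists c, (k0 + m, k').
(* The summand 0 gives the witness the shape of the linearity law in [star_rep]; its image is [m]
   times [psi a]. *)
exists (m%:~R *: a + 0); apply: weight_commutator hDe am _ => v.
have [_ [_ lin _ _]] := hpsi.
have psi0 : psi 0 v = 0.
  by have := lin (-1) 0 0 v; rewrite scaler0 addr0 scaleN1r addNr.
by rewrite lin psi0 addr0.
Qed.

Lemma commutator_in_rep_all a : commutator_in_rep psi D V a.
Proof.
have VD : V `<=` udom D.
  apply: lin_span_ind; first exact: udom0.
  by move=> z _ v [[k0 k] _ <-] Dv; apply: udom_lin => //; exact: (hDe k0 k).1.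
apply: qsphere_ind a.
- move=> i; case: (unliftP ord0 i) => [j ->|->].
    apply: (@weight_in_rep _ 0) => k0 k; exists (c1 j k), (lower k j).
    by rewrite addr0; exact: psi_genS.
  by apply: (@weight_in_rep _ 1) => k0 k; exists (c0 k), k; exact: psi_gen0.
- move=> i; case: (unliftP ord0 i) => [j ->|->].
    apply: (@weight_in_rep _ 0) => k0 k; rewrite psi_star_genS addr0.
    by eexists; exists (raise k j).
  by apply: (@weight_in_rep _ (-1)) => k0 k; rewrite psi_star_gen0; eexists; exists k.
- exact: commutator_in_rep1.
- by move=> z a b; apply: commutator_in_rep_lin => //; exact: lin_span_lin.
- exact: commutator_in_repM.
Qed.

End GeneratorAction.

Theorem mainTheorem5 (R : realType) (q : R) (hq : 1 < `|q|) (n : nat)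
  (K : hilbertType R) (f : {ffun 'I_n -> nat} -> K)
  (hf : orthonormal_basis f)
  (psi_ : R[i] -> qsphere q n -> {linear K -> K})
  (hpsi_ : forall lambda : R[i], `|lambda| = 1 ->
     is_psi_lambda f lambda (psi_ lambda))
  (H : hilbertType R) (sec : H -> R[i] -> K)
  (hsec : is_direct_integral_space sec)
  (e : int * {ffun 'I_n -> nat} -> H)
  (he : orthonormal_basis e) (he_fourier : is_fourier_basis sec f e)
  (psi : qsphere q n -> {linear H -> H})
  (hpsi : star_rep psi) (hpsi_int : is_direct_integral_rep sec psi_ psi)
  (D : unbounded_op H) (hD : self_adjoint D)
  (hDe : forall k0 k, udom D (e (k0, k)) /\
     D (e (k0, k)) = k0%:~R *: e (k0, k)) :
  let V := lin_span (range e) in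
  [/\ commutator_on V D (psi (qs_gen q ord0)) (psi (qs_gen q ord0)),
      forall i : 'I_n.+1, i != ord0 ->
        commutator_on V D (psi (qs_gen q i)) \0,
      forall a : qsphere q n,
        exists2 T : {linear H -> H}, bounded_op T & commutator_on V D (psi a) T
    & (0 < n)%N ->
        (forall mu : R[i], eigenvalue_op D mu ->
           infinite_dim (eigenspace_op D mu)) /\
        ~ has_compact_resolvent D].
Proof.
move=> V; split.
- exact: (commutator_gen0 hpsi_ hsec he_fourier hpsi_int hDe).
- exact: (commutator_genS hpsi_ hsec he_fourier hpsi_int hDe).
(* The commutator is [psi b] for some [b], and a *-representation takes bounded values. *)
- move=> a; have [_ [b ab]] :=
    commutator_in_rep_all hpsi_ hsec he he_fourier hpsi hpsi_int hDe a.
  by exists (psi b) => //; exact: hpsi.1.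
- move=> n_gt0; split; last exact: (fourier_resolvent_not_compact he hDe n_gt0).
  by move=> mu; exact: (fourier_eigenspace_infinite he hDe n_gt0 hD).
Qed.
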